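(* Let $g_1,\ldots,g_m\in\mathbb{R}[X]=\mathbb{R}[X_1,\ldots,X_n]$ and let $\mathbf{K}:=\{x\in\mathbb{R}^n : g_j(x)\geq 0,\ j=1,\ldots,m\}$. Assume that (a) $g_j$ is concave for every $j=1,\ldots,m$, and (b) there exists $z\in\mathbf{K}$ such that $g_j(z)>0$ for every $j=1,\ldots,m$. Let $$Q_c(g):=\Big\{\sigma+\sum_{j=1}^m\lambda_j\,g_j \ :\ \lambda\in\mathbb{R}^m_+,\ \sigma\in\Sigma^2,\ \sigma\text{ convex}\Big\},$$ and let $F\subset\mathbb{R}[X]$ be the convex cone of convex polynomials that are nonnegative on $\mathbf{K}$. Then $Q_c(g)\cap F$ is dense in $F$ for the $l_1$-norm $\Vert\cdot\Vert_1$ of coefficients. In particular, if $\mathbf{K}=\mathbb{R}^n$ (so that $F$ is the set of nonnegative convex polynomials), then $\Sigma^2\cap F$ is dense in $F$ for $\Vert\cdot\Vert_1$.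
   Context: $\mathbb{R}[X]$ is the ring of real polynomials in $X=(X_1,\ldots,X_n)$, and $\Sigma^2\subset\mathbb{R}[X]$ is the set of (finite) sums of squares of polynomials. For $f=\sum_{\alpha\in\mathbb{N}^n}f_\alpha X^\alpha\in\mathbb{R}[X]$, the $l_1$-norm is $\Vert f\Vert_1:=\sum_{\alpha\in\mathbb{N}^n}|f_\alpha|$. A polynomial is called convex (concave) if it is convex (concave) as a function on $\mathbb{R}^n$. $\mathbb{R}^m_+$ is the set of vectors in $\mathbb{R}^m$ with nonnegative entries. The set $\mathbf{K}$ is not assumed compact. *)

(* Defs.v *)
From HB Require Import structures.
From mathcomp Require Import all_boot all_order all_algebra.
From mathcomp Require Import classical_sets reals convex.
From mathcomp Require Import mpoly.

Set Implicit Arguments.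
Unset Strict Implicit.
Unset Printing Implicit Defensive.

Import Order.TTheory GRing.Theory Num.Theory.
Local Open Scope classical_set_scope.
Local Open Scope ring_scope.

(* [p] as a function on R^n; points of R^n are row vectors, which form an
   [lmodType] and hence fit the library's [convex_function]. *)
Definition polyfun (R : realType) (n : nat) (p : {mpoly R[n]})
  (x : 'rV[R]_n) : R := p.@[x ord0].

Definition convex_poly (R : realType) (n : nat) (p : {mpoly R[n]}) : Prop :=
  convex_function [set: 'rV[R]_n] (polyfun p).

Definition concave_poly (R : realType) (n : nat) (p : {mpoly R[n]}) : Prop :=
  convex_function [set: 'rV[R]_n] (fun x => - polyfun p x).

Definition l1norm (R : realType) (n : nat) (p : {mpoly R[n]}) : R :=
  \sum_(a <- msupp p) `|p@_a|.

Definition SOS (R : realType) (n : nat) : set {mpoly R[n]} :=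
  [set p | exists s : seq {mpoly R[n]}, p = \sum_(q <- s) q ^+ 2].

Definition Kset (R : realType) (n m : nat) (g : 'I_m -> {mpoly R[n]}) :
    set 'rV[R]_n :=
  [set x | forall j, 0 <= polyfun (g j) x].

Definition Qc (R : realType) (n m : nat) (g : 'I_m -> {mpoly R[n]}) :
    set {mpoly R[n]} :=
  [set p | exists (sigma : {mpoly R[n]}) (lambda : 'I_m -> R),
     [/\ SOS sigma, convex_poly sigma, forall j, 0 <= lambda j
       & p = sigma + \sum_(j < m) lambda j *: g j]].

Definition Fcone (R : realType) (n : nat) (K : set 'rV[R]_n) :
    set {mpoly R[n]} :=
  [set f | convex_poly f /\ forall x, K x -> 0 <= polyfun f x].

Definition l1_dense (R : realType) (n : nat) (A F : set {mpoly R[n]}) : Prop :=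
  forall f, F f -> forall e : R, 0 < e -> exists2 h, A h & l1norm (f - h) < e.

(* Main.v *)
Require Import Defs.
From HB Require Import structures.
From mathcomp Require Import all_boot all_order all_algebra.
From mathcomp Require Import classical_sets reals.
From mathcomp Require mpoly.
(* The notations of mpoly clash with those of mathcomp-analysis;
   [mpoly n R] is {mpoly R[n]}. *)
Import -(notations) mpoly.
From mathcomp Require Import interval_inference convex ring lra zify.

(** The proof splits into convex duality and an approximation of nonnegative
polynomials by sums of squares.

Duality.  Let [f] be convex and nonnegative on K.  Slater's condition yields
multipliers [c j >= 0] such that [L = f - \sum_j c j * g j] is nonnegative on
the whole of R^n ([convex_farkas]).  No separation theorem is involved: the
constraints are moved into the Lagrangian one at a time, and for a single
constraint the multiplier is the supremum of [f y / g y] over the points where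
[g y < 0].  Note that [L] is again convex.

Approximation.  A polynomial [L] that is nonnegative on R^n is an l1-limit of
sums of squares ([nonneg_l1_limit]).  Toss [N] coins with values +1 and -1 and
mean [X_i / 2] for each variable; the probability of an outcome is a product of
factors [(1 +- X_i / 2) / 2], and each such factor is an l1-limit of sums of
squares, because
[1 - t - t^(2m+1) + t^(2m+2) = (1 - t)^2 * (1 + t + ... + t^(2m))]
is a sum of squares.  As in Bernstein's proof of the Weierstrass theorem,
[L + e] is a combination of these weights, with coefficients that differ from
the values of [L + e] at the rescaled empirical means by O(1/N), hence are
nonnegative for [N] large.

Restoring convexity.  An approximation [h] of [L] need not be convex, but the
error [L - h] can be absorbed: modulo sums of squares, every monomial of degree
at most [d] is dominated by [1 + \sum_i X_i^(2d)] up to a factor depending on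
[n] only ([SOS_monomial_dominated]).  Hence [L + e * (1 + n! (1 + \sum_i
X_i^(2d)))] is a sum of squares for a suitable [d]
([SOS_add_even_power_bump]).  This perturbation is convex and nonnegative, and
its l1-norm is O(e) uniformly in [d].  So [sigma = L + perturbation] is a convex
sum of squares and [sigma + \sum_j c j * g j] is close to [f]. *)

Set Implicit Arguments.
Unset Strict Implicit.
Unset Printing Implicit Defensive.

Import Order.TTheory GRing.Theory Num.Theory.

Local Open Scope classical_set_scope.
Local Open Scope ring_scope.

Local Notation "''X_[' m ]" := (@mpolyX _ _ m)
  (at level 8, m at level 2, format "''X_[' m ]") : ring_scope.
Local Notation "''X_' i" := (@mpolyX _ _ (mnm1 i))
  (at level 8, i at level 2, format "''X_' i") : ring_scope.
Local Notation "p @_ m" := (mcoeff m p) (at level 3, m at level 2) : ring_scope.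

(** * The l1-norm is a submultiplicative norm *)

Section L1norm.
Variables (R : realType) (n : nat).
Implicit Types (p q : mpoly n R).

Lemma l1norm_superset p (s : seq (multinom n)) :
  uniq s -> {subset msupp p <= s} -> l1norm p = \sum_(a <- s) `|p@_a|.
Proof.
move=> us sub; rewrite (bigID (mem (msupp p))) /= [X in _ + X]big1 ?addr0.
  rewrite -big_filter; apply: perm_big; apply: uniq_perm.
  - exact: msupp_uniq.
  - exact: filter_uniq.
  - by move=> a; rewrite mem_filter; case: (boolP (a \in msupp p)) => //= /sub.
by move=> a /memN_msupp_eq0 ->; rewrite normr0.
Qed.

Lemma l1norm_ge0 p : 0 <= l1norm p.
Proof. exact: sumr_ge0. Qed.

Lemma l1normN p : l1norm (- p) = l1norm p.
Proof.
rewrite /l1norm (perm_big _ (msuppN p)); apply: eq_bigr => a _.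
by rewrite mcoeffN normrN.
Qed.

Lemma l1norm0 : l1norm (0 : mpoly n R) = 0.
Proof. by rewrite /l1norm msupp0 big_nil. Qed.

Lemma l1normD p q : l1norm (p + q) <= l1norm p + l1norm q.
Proof.
pose s := undup (msupp p ++ msupp q).
have us : uniq s by exact: undup_uniq.
rewrite (@l1norm_superset p s) // => [|a ap]; last first.
  by rewrite mem_undup mem_cat ap.
rewrite (@l1norm_superset q s) // => [|a aq]; last first.
  by rewrite mem_undup mem_cat aq orbT.
rewrite (@l1norm_superset (p + q) s) // => [|a]; last first.
  by move/msuppD_le; rewrite mem_undup.
by rewrite -big_split /=; apply: ler_sum => a _; rewrite mcoeffD ler_normD.
Qed.

Lemma l1normB p q : l1norm (p - q) <= l1norm p + l1norm q.
Proof. by rewrite -(l1normN q) l1normD. Qed.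

Lemma l1norm_sum (I : Type) (r : seq I) (P : pred I) (F : I -> mpoly n R) :
  l1norm (\sum_(i <- r | P i) F i) <= \sum_(i <- r | P i) l1norm (F i).
Proof.
elim/big_ind2: _ => //; first by rewrite l1norm0.
by move=> x x' y y' hx hy; apply: le_trans (l1normD _ _) (lerD hx hy).
Qed.

Lemma l1normZ c p : l1norm (c *: p) = `|c| * l1norm p.
Proof.
rewrite (@l1norm_superset (c *: p) (msupp p)).
- by rewrite mulr_sumr; apply: eq_bigr => a _; rewrite mcoeffZ normrM.
- exact: msupp_uniq.
- exact: msuppZ_le.
Qed.

Lemma l1normX m : l1norm ('X_[m] : mpoly n R) = 1.
Proof. by rewrite /l1norm msuppX big_seq1 mcoeffX eqxx normr1. Qed.

Lemma l1norm1 : l1norm (1 : mpoly n R) = 1.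
Proof. by rewrite -mpolyX0 l1normX. Qed.

Lemma l1normMn p k : l1norm (p *+ k) = l1norm p *+ k.
Proof. by rewrite -scaler_nat l1normZ normr_nat mulr_natl. Qed.

Lemma l1normM p q : l1norm (p * q) <= l1norm p * l1norm q.
Proof.
rewrite [X in l1norm (X * _)]mpolyE mulr_suml mulr_suml.
apply: le_trans (l1norm_sum _ _ _) _; apply: ler_sum => a _.
rewrite [X in l1norm (_ * X)]mpolyE !mulr_sumr.
apply: le_trans (l1norm_sum _ _ _) _; apply: ler_sum => b _.
by rewrite -scalerAl -scalerAr -mpolyXD !l1normZ l1normX mulr1.
Qed.

Lemma l1normXn p k : l1norm (p ^+ k) <= l1norm p ^+ k.
Proof.
elim: k => [|k IHk]; first by rewrite !expr0 l1norm1.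
rewrite !exprS; apply: le_trans (l1normM _ _) _.
by apply: ler_wpM2l => //; apply: l1norm_ge0.
Qed.

End L1norm.

(** * Explicit sums of squares *)

Section SOS.
Variables (R : realType) (n : nat).
Implicit Types (p q u v t : mpoly n R).

Lemma SOS_sqr p : SOS (p ^+ 2).
Proof. by exists [:: p]; rewrite big_seq1. Qed.

Lemma SOS0 : SOS (0 : mpoly n R).
Proof. by exists [::]; rewrite big_nil. Qed.

Lemma SOS1 : SOS (1 : mpoly n R).
Proof. by rewrite -(expr1n _ 2); apply: SOS_sqr. Qed.

Lemma SOSD p q : SOS p -> SOS q -> SOS (p + q).
Proof. by move=> [s ->] [s' ->]; exists (s ++ s'); rewrite big_cat. Qed.

Lemma SOS_sum (I : Type) (r : seq I) (P : pred I) (F : I -> mpoly n R) :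
  (forall i, P i -> SOS (F i)) -> SOS (\sum_(i <- r | P i) F i).
Proof. by move=> hF; elim/big_ind: _ => //; [exact: SOS0|exact: SOSD]. Qed.

Lemma SOSM p q : SOS p -> SOS q -> SOS (p * q).
Proof.
move=> [s ->] [s' ->]; rewrite big_distrlr /=.
apply: SOS_sum => x _; apply: SOS_sum => y _.
by rewrite -exprMn; apply: SOS_sqr.
Qed.

Lemma SOSX p k : SOS p -> SOS (p ^+ k).
Proof.
by move=> sp; elim: k => [|k IHk]; [exact: SOS1|rewrite exprS; exact: SOSM].
Qed.

Lemma SOSZ c p : 0 <= c -> SOS p -> SOS (c *: p).
Proof.
move=> c0 sp; rewrite -mul_mpolyC; apply: SOSM => //.
rewrite -(sqr_sqrtr c0) rmorphXn; exact: SOS_sqr.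
Qed.

Lemma SOSMn p k : SOS p -> SOS (p *+ k).
Proof. by move=> sp; rewrite -scaler_nat; apply: SOSZ. Qed.

(** Twice the sum is 1 plus p^(2m) plus the squares p^(2j) (1 + p)^2, since
consecutive even powers complete the odd power between them to a square. *)
Lemma SOS_geometric_sum p m : SOS (\sum_(i < m.*2.+1) p ^+ i).
Proof.
have -> : \sum_(i < m.*2.+1) p ^+ i =
    2^-1 *: (1 + \sum_(j < m) (p ^+ j * (1 + p)) ^+ 2 + (p ^+ m) ^+ 2).
  elim: m => [|m IHm].
    rewrite double0 big_ord1 big_ord0 !expr0 addr0 expr1n -mulr2n.
    by rewrite -scaler_nat scalerA mulVf ?scale1r ?pnatr_eq0.
  rewrite doubleS 2!big_ord_recr /= IHm [in RHS]big_ord_recr /= -!mul_mpolyC.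
  have half x : x = mpolyC n (2^-1 : R) * (2%:R * x).
    rewrite mulrA -(rmorph_nat (@mpolyC n R) 2) -rmorphM mulVf ?pnatr_eq0 //.
    by rewrite rmorph1 mul1r.
  rewrite (half (p ^+ m.*2.+1)) (half (p ^+ m.*2.+2)).
  move: (\sum_(j < m) _) => S; rewrite -muln2 !exprS !exprM; ring.
apply: SOSZ; first by rewrite invr_ge0.
apply: SOSD; last exact: SOS_sqr.
by apply: SOSD; [exact: SOS1|apply: SOS_sum => i _; exact: SOS_sqr].
Qed.

(** The tail is chosen so that the expression is (1 - p)^2 times a geometric sum
of even degree; it is small in l1-norm when p is. *)
Lemma SOS_one_sub_with_tail p m : SOS (1 - p - p ^+ m.*2.+1 + p ^+ m.*2.+2).
Proof.
have -> : 1 - p - p ^+ m.*2.+1 + p ^+ m.*2.+2 =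
    (1 - p) ^+ 2 * \sum_(i < m.*2.+1) p ^+ i.
  have geom : (1 - p) * \sum_(i < m.*2.+1) p ^+ i = 1 - p ^+ m.*2.+1.
    by rewrite -(opprB p 1) mulNr -subrX1 opprB.
  rewrite expr2 -mulrA geom !exprS; ring.
apply: SOSM (SOS_sqr _) _; exact: SOS_geometric_sum.
Qed.

(** (u^a - v^a)(u^b - v^b) is (u - v)^2 times two sums of products of powers of
u and v, and v^a u^b is a sum of squares as well. *)
Lemma SOS_two_power_mean u v a b :
  SOS u -> SOS v -> SOS (u ^+ (a + b) + v ^+ (a + b) - u ^+ a * v ^+ b).
Proof.
move=> su sv.
have -> : u ^+ (a + b) + v ^+ (a + b) - u ^+ a * v ^+ b =
    (u ^+ a - v ^+ a) * (u ^+ b - v ^+ b) + v ^+ a * u ^+ b.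
  rewrite !exprD; ring.
apply: SOSD; last by apply: SOSM; apply: SOSX.
rewrite !subrXX mulrACA -expr2; apply: SOSM; first exact: SOS_sqr.
by apply: SOSM; apply: SOS_sum => i _; apply: SOSM; apply: SOSX.
Qed.

(** A crude arithmetic-geometric mean inequality modulo sums of squares, by
splitting off one variable at a time with [SOS_two_power_mean].  The factorial
depends on the number of variables and neither on the exponents nor on d, so
that d can be taken as large as the error to be absorbed requires. *)
Lemma SOS_monomial_dominated (I : Type) (s : seq I) (u : I -> mpoly n R)
    (a : I -> nat) (d : nat) :
  (forall i, SOS (u i)) -> (\sum_(i <- s) a i <= d)%N ->
  SOS ((1 + \sum_(i <- s) u i ^+ d) *+ (size s)`! - \prod_(i <- s) u i ^+ a i).
Proof.
move=> su; elim: s d => [|i s IHs] d.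
  by move=> _; rewrite !big_nil addr0 subrr; exact: SOS0.
rewrite !big_cons => ad.
have aid : (a i <= d)%N by apply: leq_trans ad; apply: leq_addr.
have := IHs (d - a i)%N; rewrite leq_subRL // => /(_ ad).
set P := \prod_(j <- s) _; set c := (size s)`! => /(SOSM (SOSX (a i) (su i))) H.
set k := size s; set S := \sum_(j <- s) u j ^+ d.
set S' := \sum_(j <- s) u j ^+ (d - a i) in H.
have -> : (1 + (u i ^+ d + S)) *+ (size (i :: s))`! - u i ^+ a i * P =
    u i ^+ a i * ((1 + S') *+ c - P)
    + ((u i ^+ d + 1 - u i ^+ a i)
       + (u i ^+ d *+ k + S - u i ^+ a i * S') + (1 + S) *+ k) *+ c.
  have -> : (size (i :: s))`! = (k.+1 * c)%N by rewrite -factS.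
  move: (u i ^+ d) (u i ^+ a i) => x y.
  have natE j : exists j', forall z : mpoly n R, z *+ j = z * j'.
    by exists j%:R => z; rewrite mulr_natr.
  have [[k' kE] [c' cE]] := (natE k, natE c).
  rewrite mulrnA mulrS !kE !cE; ring.
apply: SOSD => //; apply: SOSMn; apply: SOSD; last first.
  by apply/SOSMn/SOSD; [exact: SOS1|apply: SOS_sum => j _; exact: SOSX].
apply: SOSD.
  have := SOS_two_power_mean (a i) (d - a i) (su i) SOS1.
  by rewrite subnKC // !expr1n mulr1.
have -> : u i ^+ d *+ k + S - u i ^+ a i * S' =
    \sum_(j <- s) (u i ^+ d + u j ^+ d - u i ^+ a i * u j ^+ (d - a i)).
  rewrite sumrB big_split /= -mulr_sumr; congr (_ + _ - _).
  by rewrite big_const_seq count_predT iter_addr_0.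
apply: SOS_sum => j _.
by have := SOS_two_power_mean (a i) (d - a i) (su i) (su j); rewrite subnKC.
Qed.

End SOS.

(** * Limits of sums of squares and absorption of the error *)

Section L1Closure.
Variables (R : realType) (n : nat).
Implicit Types (p q t f : mpoly n R).

Definition l1_limit_of_SOS p : Prop :=
  forall e : R, 0 < e -> exists2 h, SOS h & l1norm (p - h) < e.

Lemma SOS_l1_limit p : SOS p -> l1_limit_of_SOS p.
Proof. by move=> sp e e0; exists p => //; rewrite subrr l1norm0. Qed.

Lemma l1_limitD p q :
  l1_limit_of_SOS p -> l1_limit_of_SOS q -> l1_limit_of_SOS (p + q).
Proof.
move=> lp lq e e0; have e2 : 0 < e / 2 by rewrite divr_gt0.
have [h sh ph] := lp _ e2; have [k sk qk] := lq _ e2.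
exists (h + k); first exact: SOSD.
rewrite opprD addrACA; apply: le_lt_trans (l1normD _ _) _.
by rewrite (splitr e) ltrD.
Qed.

Lemma l1_limit_sum (I : Type) (r : seq I) (P : pred I) (F : I -> mpoly n R) :
  (forall i, P i -> l1_limit_of_SOS (F i)) ->
  l1_limit_of_SOS (\sum_(i <- r | P i) F i).
Proof.
move=> hF; elim/big_ind: _ => //; last exact: l1_limitD.
exact/SOS_l1_limit/SOS0.
Qed.

Lemma l1_limitM p q :
  l1_limit_of_SOS p -> l1_limit_of_SOS q -> l1_limit_of_SOS (p * q).
Proof.
move=> lp lq e e0.
have half (x : R) : 0 <= x -> x * (e / (2 * (x + 1))) < e / 2.
  move=> x0; have x1 : 0 < x + 1 by rewrite ltr_wpDl.
  rewrite invfM [e * _]mulrA mulrCA -[ltRHS]mulr1 ltr_pM2l ?divr_gt0 //.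
  by rewrite ltr_pdivrMr // mul1r ltrDl.
pose a := l1norm p; have a0 : 0 <= a by exact: l1norm_ge0.
have [k sk qk] : exists2 k, SOS k & l1norm (q - k) < e / (2 * (a + 1)).
  by apply: lq; rewrite divr_gt0 // mulr_gt0 // ltr_wpDl.
pose c := l1norm k.
have c0 : 0 <= c by exact: l1norm_ge0.
have [h sh ph] : exists2 h, SOS h & l1norm (p - h) < e / (2 * (c + 1)).
  by apply: lp; rewrite divr_gt0 // mulr_gt0 // ltr_wpDl.
exists (h * k); first exact: SOSM.
have -> : p * q - h * k = p * (q - k) + (p - h) * k by ring.
apply: le_lt_trans (l1normD _ _) _; rewrite (splitr e); apply: ltrD.
- apply: le_lt_trans (l1normM _ _) _; rewrite -/a.
  apply: le_lt_trans (half _ a0); exact: ler_wpM2l (ltW qk).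
- apply: le_lt_trans (l1normM _ _) _; rewrite -/c mulrC.
  apply: le_lt_trans (half _ c0); exact: ler_wpM2l (ltW ph).
Qed.

Lemma l1_limit_prod (I : Type) (r : seq I) (P : pred I) (F : I -> mpoly n R) :
  (forall i, P i -> l1_limit_of_SOS (F i)) ->
  l1_limit_of_SOS (\prod_(i <- r | P i) F i).
Proof.
move=> hF; elim/big_ind: _ => //; last exact: l1_limitM.
exact/SOS_l1_limit/SOS1.
Qed.

Lemma l1_limitZ c p : 0 <= c -> l1_limit_of_SOS p -> l1_limit_of_SOS (c *: p).
Proof.
move=> c0 lp; rewrite -mul_mpolyC -[mpolyC n c]mulr1 mul_mpolyC.
apply: l1_limitM => //; apply: SOS_l1_limit; apply: SOSZ => //; exact: SOS1.
Qed.

(** The set of l1-limits is closed, and the constants tend to 0. *)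
Lemma l1_limit_of_upward p :
  (forall e, 0 < e -> l1_limit_of_SOS (p + e *: 1)) -> l1_limit_of_SOS p.
Proof.
move=> lp e e0; have e2 : 0 < e / 2 by rewrite divr_gt0.
have [h sh ph] := lp _ e2 _ e2; exists h => //.
have -> : p - h = (p + (e / 2) *: 1 - h) - (e / 2) *: 1 by rewrite addrAC addrK.
apply: le_lt_trans (l1normB _ _) _.
by rewrite l1normZ l1norm1 mulr1 (ger0_norm (ltW e2)) [ltRHS]splitr ltrD2r.
Qed.

Lemma l1_limit_one_sub t : l1norm t <= 2^-1 -> l1_limit_of_SOS (1 - t).
Proof.
move=> t_small e e0.
have [m m_large] : exists m, 2 * 2^-1 ^+ m < e.
  exists (Num.bound (2 / e)); rewrite exprVn ltr_pdivrMr ?exprn_gt0 //.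
  rewrite mulrC -ltr_pdivrMr //.
  apply: lt_trans (archi_boundP _) _; first by rewrite divr_ge0 // ltW.
  by rewrite -natrX ltr_nat ltn_expl.
exists (1 - t - t ^+ m.*2.+1 + t ^+ m.*2.+2).
  exact: SOS_one_sub_with_tail.
have -> : 1 - t - (1 - t - t ^+ m.*2.+1 + t ^+ m.*2.+2) =
  t ^+ m.*2.+1 - t ^+ m.*2.+2 by ring.
apply: le_lt_trans m_large; apply: le_trans (l1normB _ _) _.
have pow_small k : (m <= k)%N -> l1norm (t ^+ k) <= 2^-1 ^+ m.
  move=> mk; apply: le_trans (l1normXn _ _) _.
  apply: le_trans (lerXn2r k _ _ t_small) _; rewrite ?nnegrE ?l1norm_ge0 //.
  by apply: ler_wiXn2l => //; rewrite invf_le1 ?ler1n.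
rewrite mulrDl mul1r; apply: lerD; apply: pow_small;
  by rewrite -addnn -!addSn leq_addl.
Qed.

(** The perturbation that absorbs all monomials X^m of degree at most d: the
part with the factorial dominates X^(2m) by [SOS_monomial_dominated], and the
summand 1 provides the constant of the completed square (1 +- X^m)^2. *)
Definition even_power_bump d : mpoly n R :=
  1 + (1 + \sum_(i < n) ('X_i ^+ 2) ^+ d) *+ n`!.

(** Uniformity in d is the point: the degree needed to absorb an error is not
controlled by the l1-norm of the error. *)
Lemma l1norm_even_power_bump d :
  l1norm (even_power_bump d) <= 1 + (1 + n%:R) *+ n`!.
Proof.
apply: le_trans (l1normD _ _) _; rewrite l1norm1 lerD2l l1normMn lerMn2r.
apply/orP; right; apply: le_trans (l1normD _ _) _; rewrite l1norm1 lerD2l.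
apply: le_trans (l1norm_sum _ _ _) _.
rewrite -[n in n%:R]card_ord -sum1_card natr_sum; apply: ler_sum => i _.
by rewrite -exprM mpolyXn l1normX.
Qed.

(** With h a sum of squares close to f, each term c X^m of f - h is absorbed by
completing the square: c X^m + |c| (1 + X^(2m)) / 2 = |c| (1 +- X^m)^2 / 2, and
X^(2m) is dominated by the bump. *)
Lemma SOS_add_even_power_bump f (e : R) :
  l1_limit_of_SOS f -> 0 < e -> exists d, SOS (f + e *: even_power_bump d).
Proof.
move=> lf e0; have [h sh fh] := lf _ e0.
pose err := f - h; pose d := (\sum_(m <- msupp err) mdeg m)%N.
exists d; set b := even_power_bump d.
have bE : b - 1 = (1 + \sum_(i < n) ('X_i ^+ 2) ^+ d) *+ n`!.
  by rewrite addrC addKr.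
have sb : SOS (b - 1).
  rewrite bE; apply/SOSMn/SOSD; first exact: SOS1.
  by apply: SOS_sum => i _; apply/SOSX/SOS_sqr.
have dom m : m \in msupp err -> SOS (b - 1 - 'X_[m] ^+ 2).
  move=> merr; rewrite bE.
  have md : (\sum_(i <- index_enum 'I_n) m i <= d)%N.
    by rewrite -mdegE /d (big_rem m) //= leq_addr.
  have := SOS_monomial_dominated (fun i => SOS_sqr 'X_i) md.
  rewrite [size _](_ : _ = n); last by rewrite -[RHS]card_ord cardT enumT.
  have -> : 'X_[m] ^+ 2 = \prod_(i < n) ('X_i ^+ 2 : mpoly n R) ^+ m i.
    rewrite [X in X ^+ 2]mpolyXE_id -prodrXl; apply: eq_bigr => i _.
    by rewrite -!exprM mulnC.
  by [].
have -> : f + e *: b = h + (e - l1norm err) *: b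
   + \sum_(m <- msupp err) (err@_m *: 'X_[m] + `|err@_m| *: b).
  rewrite big_split /= -mpolyE -scaler_suml scalerBl.
  by rewrite /l1norm /err; ring.
apply: SOSD.
  apply: SOSD => //; apply: SOSZ; first by rewrite subr_ge0 ltW.
  by rewrite -(subrK 1 b); apply: SOSD => //; apply: SOS1.
rewrite big_seq; apply: SOS_sum => m merr; set c := err@_m.
have -> : c *: 'X_[m] + `|c| *: b = (`|c| / 2) *: (1 + Num.sg c *: 'X_[m]) ^+ 2
   + (`|c| / 2) *: (b - 1 - 'X_[m] ^+ 2) + (`|c| / 2) *: b.
  have cE : c = (`|c| / 2) * Num.sg c * 2.
    by rewrite mulrAC divfK // mulrC -numEsg.
  have sgE : (`|c| / 2) * (Num.sg c ^+ 2) = `|c| / 2.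
    by rewrite sqr_sg; case: eqVneq => [->|]; rewrite ?normr0 ?mul0r ?mulr1.
  have nE : `|c| = (`|c| / 2) * 2 by rewrite divfK.
  rewrite {1}cE {2}nE; move: (`|c| / 2) (Num.sg c) sgE => a s as2.
  transitivity ((a * s * 2) *: 'X_[m] + (a * 2) *: b
                + (a * s ^+ 2 - a) *: 'X_[m] ^+ 2).
    by rewrite as2 subrr scale0r addr0.
  rewrite -!mul_mpolyC !(mpolyCM, mpolyCB, mpolyC_nat, rmorphXn) /=; ring.
apply: SOSD; first apply: SOSD; apply: SOSZ; rewrite ?divr_ge0 //.
- exact: SOS_sqr.
- exact: dom.
- by rewrite -(subrK 1 b); apply: SOSD => //; apply: SOS1.
Qed.

End L1Closure.

(** * Moments of coin tosses *)

Section CoinFlips.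
Variables (R : realType) (N : nat).
Implicit Types (s : {ffun 'I_N -> bool}) (k : nat).

Definition coin_mean s : R := N%:R^-1 * \sum_(i < N) (-1) ^+ s i.

(** The average of the products of k distinct tosses.  Unlike the k-th power of
the mean, it is an unbiased estimator of the k-th power of the expected value
of one toss, which is what makes [coin_moment_repr] exact. *)
Definition coin_moment k s : R :=
  (N ^_ k)%:R^-1 * \sum_(u : {ffun 'I_k -> 'I_N} | injectiveb u)
                     \prod_(l < k) (-1) ^+ s (u l).

Lemma card_injective_draws k :
  #|[pred u : {ffun 'I_k -> 'I_N} | injectiveb u]| = (N ^_ k)%N.
Proof.
by have := card_inj_ffuns 'I_k 'I_N; rewrite !card_ord => <-; rewrite cardsE.
Qed.

Lemma norm_draw s k (u : {ffun 'I_k -> 'I_N}) :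
  `|\prod_(l < k) (-1) ^+ s (u l) : R| = 1.
Proof. by rewrite normr_prod big1 // => l _; rewrite normrX normrN1 expr1n. Qed.

Lemma norm_sum_draws s k (P : pred {ffun 'I_k -> 'I_N}) :
  `|\sum_(u | P u) \prod_(l < k) (-1) ^+ s (u l) : R| <= #|P|%:R.
Proof.
apply: le_trans (ler_norm_sum _ _ _) _.
by rewrite (eq_bigr (fun=> 1)) ?sumr_const // => u _; rewrite norm_draw.
Qed.

Lemma coin_mean_expE k s : coin_mean s ^+ k =
  (N ^ k)%:R^-1 * \sum_(u : {ffun 'I_k -> 'I_N}) \prod_(l < k) (-1) ^+ s (u l).
Proof.
rewrite exprMn exprVn natrX; congr (_ * _).
by rewrite -[k in LHS]card_ord -prodr_const bigA_distr_bigA.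
Qed.

Lemma norm_coin_moment k s : `|coin_moment k s| <= 1.
Proof.
rewrite normrM normfV normr_nat; have [->|ff0] := posnP (N ^_ k)%N.
  by rewrite invr0 mul0r.
rewrite mulrC ler_pdivrMr ?ltr0n // mul1r.
by rewrite -card_injective_draws; apply: norm_sum_draws.
Qed.

Lemma norm_coin_mean_exp k s : `|coin_mean s ^+ k| <= 1.
Proof.
rewrite normrX; apply: exprn_ile1 => //.
rewrite normrM normfV normr_nat; have [N0|N0] := posnP N.
  by rewrite {1}N0 invr0 mul0r.
rewrite mulrC ler_pdivrMr ?ltr0n // mul1r.
apply: le_trans (ler_norm_sum _ _ _) _.
rewrite (eq_bigr (fun=> 1)) ?sumr_const ?card_ord // => i _.
by rewrite normrX normrN1 expr1n.
Qed.

(** The left-hand side is the probability that k random draws collide. *)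
Lemma collision_probability_le k : (0 < N)%N ->
  1 - (N ^_ k)%:R / (N ^ k)%:R <= (k ^ 2)%:R / N%:R :> R.
Proof.
move=> N0; have NR0 : 0 < N%:R :> R by rewrite ltr0n.
elim: k => [|k IHk]; first by rewrite ffactn0 expn0 divr1 subrr mul0r.
set r := _ / _ in IHk *.
have r1 : r <= 1.
  rewrite ler_pdivrMr ?ltr0n ?expn_gt0 ?N0 // mul1r ler_nat.
  by rewrite -[N in (_ <= N ^ k)%N]card_ord -[k in (_ <= _ ^ k)%N]card_ord
    -card_ffun -card_injective_draws max_card.
have r0 : 0 <= r by rewrite divr_ge0.
have step : r * (1 - k%:R / N%:R) <= (N ^_ k.+1)%:R / (N ^ k.+1)%:R.
  rewrite ffactnSr expnSr !natrM invfM mulrACA; apply: ler_wpM2l => //.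
  have -> : 1 - k%:R / N%:R = (N%:R - k%:R) / N%:R :> R.
    by rewrite mulrBl divff ?gt_eqF.
  rewrite ler_pM2r ?invr_gt0 //.
  by rewrite lerBlDr -natrD ler_nat addnC -leq_subLR.
apply: le_trans (lerB (lexx 1) step) _.
have -> : 1 - r * (1 - k%:R / N%:R) = (1 - r) + r * (k%:R / N%:R) by ring.
have : r * (k%:R / N%:R) <= k%:R / N%:R.
  by apply: ler_piMl => //; apply: divr_ge0.
move=> /(lerD IHk) /le_trans; apply.
rewrite -mulrDl ler_pM2r ?invr_gt0 // -natrD ler_nat; nia.
Qed.

(** The k-th power of the mean averages over all draws of k tosses, the moment
over the injective ones only, and every product is +1 or -1: the difference is
at most twice the proportion of draws with a collision. *)
Lemma coin_moment_approx k s : (0 < N)%N ->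
  `|coin_moment k s - coin_mean s ^+ k| <= 2 * (k ^ 2)%:R / N%:R.
Proof.
move=> N0; rewrite -mulrA.
apply: le_trans (ler_wpM2l _ (collision_probability_le k N0)) => //.
rewrite coin_mean_expE (bigID (fun u : {ffun 'I_k -> 'I_N} => injectiveb u)) /=.
rewrite mulrDr opprD addrA.
set A := \sum_(u | _) _; set B := \sum_(u | _) _.
have Nk0 : 0 < (N ^ k)%:R :> R by rewrite ltr0n expn_gt0 N0.
have normB : `|(N ^ k)%:R^-1 * B| <= 1 - (N ^_ k)%:R / (N ^ k)%:R.
  rewrite normrM normfV normr_nat mulrC ler_pdivrMr // mulrBl mul1r.
  rewrite divfK ?gt_eqF //; apply: le_trans (norm_sum_draws _ _) _.
  rewrite lerBrDr -natrD ler_nat -(card_injective_draws k).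
  have := cardC [pred u : {ffun 'I_k -> 'I_N} | injectiveb u].
  by rewrite card_ffun !card_ord addnC => <-.
apply: le_trans (ler_normB _ _) _; rewrite mulrDl mul1r; apply: lerD => //.
have [ff0|ff0] := posnP (N ^_ k)%N.
  have A0 : A = 0.
    apply/eqP; rewrite -normr_le0; apply: le_trans (norm_sum_draws _ _) _.
    by rewrite card_injective_draws ff0.
  by rewrite /coin_moment -/A A0 !mulr0 subrr normr0 ff0 mul0r subr0.
have ffR : 0 < (N ^_ k)%:R :> R by rewrite ltr0n.
have -> : coin_moment k s - (N ^ k)%:R^-1 * A =
    coin_moment k s * (1 - (N ^_ k)%:R / (N ^ k)%:R).
  rewrite /coin_moment -/A; field; rewrite !gt_eqF //.
rewrite normrM [`|1 - _|]ger0_norm ?ler_piMl ?norm_coin_moment //.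
  exact: le_trans normB.
exact: le_trans normB.
Qed.

Variable n : nat.
Implicit Types t : mpoly n R.

(** The probability of the outcome s for independent coins of expected value t,
taken as a polynomial in t. *)
Definition coin_weight t s : mpoly n R :=
  \prod_(i < N) (2^-1 *: (1 + (-1) ^+ s i *: t)).

(** The expectation of a product of k distinct tosses is t^k by independence. *)
Lemma coin_moment_repr k t : (k <= N)%N ->
  t ^+ k = \sum_s coin_moment k s *: coin_weight t s.
Proof.
move=> kN; have ffR : (N ^_ k)%:R != 0 :> R.
  by rewrite pnatr_eq0 -lt0n ffact_gt0.
under eq_bigr do rewrite -scalerA scaler_suml.
rewrite -scaler_sumr exchange_big /=.
rewrite (eq_bigr (fun=> t ^+ k)) => [|u uI].
  rewrite sumr_const card_injective_draws -scaler_nat scalerA mulVf //.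
  by rewrite scale1r.
pose F i (b : bool) : mpoly n R := (if i \in codom u then (-1) ^+ b else 1) *:
  (2^-1 *: (1 + (-1) ^+ b *: t)).
transitivity (\sum_(s : {ffun 'I_N -> bool}) \prod_i F i (s i)).
  apply: eq_bigr => s _; rewrite /coin_weight /F [RHS]scaler_prod.
  congr (_ *: _).
  by rewrite -big_mkcond /= -(big_uniq _ uI) big_image.
have F2 i : \sum_b F i b = if i \in codom u then t else 1.
  have half (x : mpoly n R) : 2^-1 *: (x + x) = x.
    by rewrite -mulr2n -scaler_nat scalerA mulVf ?pnatr_eq0 ?scale1r.
  rewrite big_bool /F /= expr0 expr1 scaleN1r !scale1r.
  case: ifP => _; rewrite ?scaleN1r ?scale1r -?scalerN -scalerDr -[RHS]half.
    by congr (_ *: _); ring.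
  by congr (_ *: _); ring.
rewrite -(bigA_distr_bigA F) (eq_bigr _ (fun i _ => F2 i)) -big_mkcond /=.
rewrite prodr_const card_codom ?card_ord //; exact/injectiveP.
Qed.

End CoinFlips.

(** * Nonnegative polynomials are limits of sums of squares *)

Section NonnegativeIsLimit.
Variables (R : realType) (n : nat).

Lemma norm_prod_sub (I : Type) (r : seq I) (a b : I -> R) :
  (forall i, `|a i| <= 1) -> (forall i, `|b i| <= 1) ->
  `|\prod_(i <- r) a i - \prod_(i <- r) b i| <= \sum_(i <- r) `|a i - b i|.
Proof.
move=> a1 b1; elim: r => [|i r IHr]; first by rewrite !big_nil subrr normr0.
rewrite !big_cons; set A := \prod_(j <- r) a j; set B := \prod_(j <- r) b j.
have -> : a i * A - b i * B = (a i - b i) * A + b i * (A - B) by ring.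
apply: le_trans (ler_normD _ _) _; rewrite !normrM; apply: lerD.
  apply: ler_piMr => //; rewrite normr_prod.
  by apply: prodr_ile1 => j _; rewrite normr_ge0 a1.
by apply: le_trans IHr; apply: ler_piMl.
Qed.

Lemma l1_limit_coin_weight N (t : mpoly n R) (s : {ffun 'I_N -> bool}) :
  l1norm t <= 2^-1 -> l1_limit_of_SOS (coin_weight t s).
Proof.
move=> t2; apply: l1_limit_prod => i _; apply: l1_limitZ.
  by rewrite invr_ge0.
rewrite -[_ *: t]opprK; apply: l1_limit_one_sub.
by rewrite l1normN l1normZ normrX normrN1 expr1n mul1r.
Qed.

(** Bernstein approximation on the cube of half-side 2.  The coin mean X_i / 2
has l1-norm 1/2, which places the weights among the limits of sums of squares; the
grid points are twice the empirical means. *)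
Lemma nonneg_l1_limit (f : mpoly n R) :
  (forall x, 0 <= polyfun f x) -> l1_limit_of_SOS f.
Proof.
move=> f0; apply: l1_limit_of_upward => e e0.
(* [B / N] bounds the deviation of the coefficients from the values of [f]. *)
pose B : R := \sum_(m <- msupp f)
  `|f@_m| * 2 ^+ mdeg m * \sum_(i < n) 2 * (m i ^ 2)%:R.
have B0 : 0 <= B.
  by apply: sumr_ge0 => m _; rewrite !mulr_ge0 ?exprn_ge0 // sumr_ge0.
pose N := (Num.bound (B / e) + \sum_(m <- msupp f) mdeg m).+1.
have NR0 : 0 < N%:R :> R by rewrite ltr0n.
have BN : B / N%:R <= e.
  rewrite ler_pdivrMr // mulrC -ler_pdivrMr //; apply: ltW.
  apply: lt_le_trans (archi_boundP _) _; first by rewrite divr_ge0 // ltW.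
  by rewrite ler_nat /N -addSn leqW ?leq_addr.
pose t (i : 'I_n) : mpoly n R := 2^-1 *: 'X_i.
pose W (S : {ffun 'I_n -> {ffun 'I_N -> bool}}) :=
  \prod_(i < n) coin_weight (t i) (S i).
pose a m (S : {ffun 'I_n -> {ffun 'I_N -> bool}}) : R :=
  2 ^+ mdeg m * \prod_(i < n) coin_moment R (m i) (S i).
have monoE m : (mdeg m <= N)%N -> 'X_[m] = \sum_S a m S *: W S.
  move=> mN; have tE i : 'X_i = 2%:R *: t i :> mpoly n R.
    by rewrite /t scalerA divff ?scale1r // pnatr_eq0.
  rewrite mpolyXE_id; under eq_bigr do rewrite tE exprZn.
  rewrite scaler_prod prodrXr -mdegE.
  under eq_bigr => i _.
    rewrite (@coin_moment_repr _ N); last first.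
      by apply: leq_trans mN; rewrite mdegE (bigD1 i) //= leq_addr.
    over.
  rewrite bigA_distr_bigA scaler_sumr; apply: eq_bigr => S _.
  by rewrite scaler_prod scalerA.
(* The zeroth moment is 1 since it is within 0 of the zeroth power. *)
have one_a S : a mnm0 S = 1.
  rewrite /a mdeg0 expr0 mul1r big1 // => i _; rewrite mnmE.
  apply/eqP; rewrite -subr_eq0 -normr_le0 -(expr0 (coin_mean R (S i))).
  by apply: le_trans (coin_moment_approx _ _ _ _) _; rewrite // mulr0 mul0r.
have -> : f + e *: 1 = \sum_S (\sum_(m <- msupp f) f@_m * a m S + e) *: W S.
  under eq_bigr do rewrite scalerDl scaler_suml.
  rewrite big_split exchange_big /=; congr (_ + _).
    rewrite [LHS]mpolyE [LHS]big_seq [RHS]big_seq; apply: eq_bigr => m mf.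
    rewrite monoE ?scaler_sumr; first by apply: eq_bigr => S _; rewrite scalerA.
    by rewrite /N (big_rem m) //= addnCA leqW ?leq_addr.
  rewrite -mpolyX0 monoE ?mdeg0 // scaler_sumr; apply: eq_bigr => S _.
  by rewrite one_a scale1r.
apply: l1_limit_sum => S _; apply: l1_limitZ; last first.
  apply: l1_limit_prod => i _; apply: l1_limit_coin_weight.
  by rewrite l1normZ l1normX mulr1 ger0_norm // invr_ge0.
pose y : 'rV[R]_n := \row_i (2 * coin_mean R (S i)).
have yE : polyfun f y = \sum_(m <- msupp f) f@_m *
    (2 ^+ mdeg m * \prod_(i < n) coin_mean R (S i) ^+ m i).
  rewrite /polyfun mevalE; apply: eq_bigr => m _; congr (_ * _).
  rewrite mdegE -prodrXr -big_split /=; apply: eq_bigr => i _.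
  by rewrite mxE exprMn.
have close : `|\sum_(m <- msupp f) f@_m * a m S - polyfun f y| <= B / N%:R.
  rewrite yE -sumrB mulr_suml; apply: le_trans (ler_norm_sum _ _ _) _.
  apply: ler_sum => m _; rewrite -mulrBr -mulrBr !normrM -!mulrA.
  apply: ler_wpM2l => //; rewrite ger0_norm ?exprn_ge0 //.
  apply: ler_wpM2l; first by rewrite exprn_ge0.
  apply: le_trans (norm_prod_sub _ _ _) _ => [i|i|].
  - exact: norm_coin_moment.
  - exact: norm_coin_mean_exp.
  - by rewrite mulr_suml; apply: ler_sum => i _; apply: coin_moment_approx.
have := f0 y; have := le_trans close BN.
by rewrite ler_norml => /andP[]; lra.
Qed.

End NonnegativeIsLimit.

(** * Convex Lagrange duality *)

Section ConvexFarkas.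
Variables (R : realType) (V : lmodType R).
Implicit Types (D : set V) (f g : V -> R).

Definition segment_closed D := forall x y (t : R), D x -> D y -> 0 <= t <= 1 ->
  D (t *: x + (1 - t) *: y).

Definition convex_on D f := forall x y (t : R), D x -> D y -> 0 <= t <= 1 ->
  f (t *: x + (1 - t) *: y) <= t * f x + (1 - t) * f y.

(** The multiplier has to lie above all f y / g y with g y < 0 and below all
f x / g x with g x > 0.  These bounds are compatible: the segment from x to y
contains a point where the chord of g vanishes, so that g and hence f are
nonnegative there, and convexity of f compares the two slopes. *)
Lemma convex_farkas_one_constraint D f g z : segment_closed D ->
  convex_on D f -> convex_on D (fun x => - g x) ->
  (forall x, D x -> 0 <= g x -> 0 <= f x) -> D z -> 0 < g z ->
  exists2 c, 0 <= c & forall x, D x -> 0 <= f x - c * g x.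
Proof.
move=> cD cf cg fg Dz gz.
(* Including 0 makes the set nonempty and its supremum nonnegative. *)
pose A := [set r : R | r = 0 \/ exists y, [/\ D y, g y < 0 & r = f y / g y]].
have ubA x : D x -> 0 < g x -> ubound A (f x / g x).
  move=> Dx gx r [->|[y [Dy gy ->]]].
    by apply: divr_ge0; [apply: fg => //|]; exact: ltW.
  rewrite ler_ndivrMr // mulrAC ler_pdivrMr //.
  have gxy : 0 < g x - g y by lra.
  (* The weight at which the chord of [g] vanishes. *)
  pose t := - g y / (g x - g y).
  have t01 : 0 <= t <= 1.
    apply/andP; split; last by rewrite ler_pdivrMr //; lra.
    by apply: divr_ge0; apply: ltW; rewrite // oppr_gt0.
  have tE : t * (g x - g y) = - g y by rewrite divfK // gt_eqF.
  have Dp := cD x y t Dx Dy t01.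
  have gp : 0 <= g (t *: x + (1 - t) *: y).
    have := cg x y t Dx Dy t01 => /=.
    have : t * g x + (1 - t) * g y = 0 by have := tE; lra.
    lra.
  have := le_trans (fg _ Dp gp) (cf x y t Dx Dy t01).
  move=> /(mulr_ge0 (ltW gxy)).
  have -> : (g x - g y) * (t * f x + (1 - t) * f y) =
    (t * (g x - g y)) * f x + ((g x - g y) - t * (g x - g y)) * f y by ring.
  rewrite tE; nra.
have A0 : A 0 by left.
have supA : has_sup A by split; [exists 0|exists (f z / g z); exact: ubA].
exists (sup A); first exact: sup_upper_bound.
move=> x Dx; rewrite subr_ge0; have [gx|gx|gx] := ltgtP (g x) 0.
- rewrite -ler_ndivrMr //; apply: sup_upper_bound => //; right.
  by exists x.
- by rewrite -ler_pdivlMr //; apply: ge_sup; [exists 0|exact: ubA].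
- by rewrite gx mulr0 fg // gx.
Qed.

(** Induction on the number of constraints: the constraints other than the first
are dualized over the smaller domain where the first one holds, and the
resulting Lagrangian is again convex. *)
Lemma convex_farkas m D f (g : 'I_m -> V -> R) z : segment_closed D ->
  convex_on D f -> (forall j, convex_on D (fun x => - g j x)) ->
  (forall x, D x -> (forall j, 0 <= g j x) -> 0 <= f x) ->
  D z -> (forall j, 0 < g j z) ->
  exists2 c : 'I_m -> R, forall j, 0 <= c j
    & forall x, D x -> 0 <= f x - \sum_j c j * g j x.
Proof.
elim: m D f g => [|m IHm] D f g cD cf cg fg Dz gz.
  exists (fun=> 0) => // x Dx; rewrite big_ord0 subr0; apply: fg => //.
  by case.
pose D' := [set x | D x /\ 0 <= g ord0 x].
have [c c0 fc] : exists2 c : 'I_m -> R, forall j, 0 <= c j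
    & forall x, D' x -> 0 <= f x - \sum_j c j * g (lift ord0 j) x.
  apply: IHm => //.
  - move=> x y t [Dx gx] [Dy gy] t01; split; first exact: cD.
    have := cg ord0 x y t Dx Dy t01; nra.
  - by move=> x y t [Dx _] [Dy _]; apply: cf.
  - by move=> j x y t [Dx _] [Dy _]; apply: cg.
  - move=> x [Dx gx] gj; apply: fg => // j.
    by case: (unliftP ord0 j) => [k ->|->].
  - by split => //; apply: ltW.
have [c1 c10 fc1] : exists2 c1, 0 <= c1
    & forall x, D x ->
        0 <= f x - \sum_j c j * g (lift ord0 j) x - c1 * g ord0 x.
  apply: (@convex_farkas_one_constraint D
    (fun x => f x - \sum_j c j * g (lift ord0 j) x) (g ord0) z) => //.
  - move=> x y t Dx Dy t01; have := cf x y t Dx Dy t01.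
    have : t * (- \sum_j c j * g (lift ord0 j) x)
        + (1 - t) * (- \sum_j c j * g (lift ord0 j) y)
        + \sum_j c j * g (lift ord0 j) (t *: x + (1 - t) *: y) >= 0.
      rewrite -!sumrN !mulr_sumr -!big_split; apply: sumr_ge0 => j _ /=.
      have := cg (lift ord0 j) x y t Dx Dy t01; have := c0 j; nra.
    lra.
  - by move=> x Dx gx; apply: fc.
exists (fun j => if unlift ord0 j is Some k then c k else c1) => [j|x Dx].
  by case: unliftP.
rewrite big_ord_recl unlift_none; under eq_bigr do rewrite liftK.
by have := fc1 x Dx; lra.
Qed.

End ConvexFarkas.

(** * Convex polynomials and the density theorem *)

Section ConvexPolynomials.
Variables (R : realType) (n : nat).
Implicit Types (f p : mpoly n R).

Lemma convex_polyP p : convex_poly p <-> convex_on setT (polyfun p).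
Proof.
split=> [cp x y t _ _ /andP[t0 t1]|cp t x y _ _].
  by have := cp (Itv01 t0 t1) x y (in_setT _) (in_setT _).
by apply: cp => //; rewrite ge0 le1.
Qed.

Lemma concave_polyP p :
  concave_poly p <-> convex_on setT (fun x => - polyfun p x).
Proof.
split=> [cp x y t _ _ /andP[t0 t1]|cp t x y _ _].
  by have := cp (Itv01 t0 t1) x y (in_setT _) (in_setT _).
by apply: cp => //; rewrite ge0 le1.
Qed.

Lemma convex_polyD f p : convex_poly f -> convex_poly p -> convex_poly (f + p).
Proof.
move=> /convex_polyP cf /convex_polyP cp; apply/convex_polyP => x y t Dx Dy t01.
rewrite /polyfun !mevalD; have := cf x y t Dx Dy t01.
by have := cp x y t Dx Dy t01; rewrite /polyfun; lra.
Qed.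

Lemma convex_polyZ c p : 0 <= c -> convex_poly p -> convex_poly (c *: p).
Proof.
move=> c0 /convex_polyP cp; apply/convex_polyP => x y t Dx Dy t01.
rewrite /polyfun !mevalZ; have := cp x y t Dx Dy t01.
by rewrite /polyfun; nra.
Qed.

Lemma convex_poly_const c : convex_poly (mpolyC n c : mpoly n R).
Proof.
apply/convex_polyP => x y t _ _ _; rewrite /polyfun !mevalC; lra.
Qed.

Lemma convex_poly_sum (I : Type) (r : seq I) (F : I -> mpoly n R) :
  (forall i, convex_poly (F i)) -> convex_poly (\sum_(i <- r) F i).
Proof.
move=> cF; elim/big_ind: _ => //; last exact: convex_polyD.
by rewrite -(mpolyC0 n R); apply: convex_poly_const.
Qed.

(** The induction step is the Chebyshev inequality (a^d - b^d)(a - b) >= 0. *)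
Lemma exprn_convex d (a b t : R) : 0 <= a -> 0 <= b -> 0 <= t <= 1 ->
  (t * a + (1 - t) * b) ^+ d <= t * a ^+ d + (1 - t) * b ^+ d.
Proof.
move=> a0 b0 t01; elim: d => [|d IHd]; first by rewrite !expr0; lra.
have m0 : 0 <= t * a + (1 - t) * b by nra.
rewrite exprSr; apply: le_trans (ler_wpM2r m0 IHd) _.
have cheb : 0 <= (a ^+ d - b ^+ d) * (a - b).
  by rewrite subrXX mulrAC -expr2 mulr_ge0 ?sqr_ge0 // sumr_ge0 // => i _;
    rewrite mulr_ge0 ?exprn_ge0.
rewrite !exprSr; have : 0 <= t * (1 - t) by nra.
by move=> /(mulr_ge0 cheb); lra.
Qed.

Lemma convex_even_power_bump d : convex_poly (even_power_bump R n d).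
Proof.
rewrite /even_power_bump -scaler_nat -[1](mpolyC1 n R).
apply: convex_polyD; first exact: convex_poly_const.
apply: convex_polyZ => //; apply: convex_polyD; first exact: convex_poly_const.
apply: convex_poly_sum => i; apply/convex_polyP => x y t _ _ t01.
rewrite /polyfun !rmorphXn /= !mevalXU !mxE.
apply: le_trans (exprn_convex _ (sqr_ge0 _) (sqr_ge0 _) t01).
apply: lerXn2r; rewrite ?nnegrE ?sqr_ge0 //.
  by have := sqr_ge0 (x ord0 i); have := sqr_ge0 (y ord0 i); nra.
have : 0 <= t * (1 - t) * (x ord0 i - y ord0 i) ^+ 2.
  by rewrite mulr_ge0 ?sqr_ge0 //; nra.
lra.
Qed.

Lemma polyfun_even_power_bump_ge0 d x : 0 <= polyfun (even_power_bump R n d) x.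
Proof.
rewrite /polyfun /even_power_bump mevalD mevalMn mevalD meval1 raddf_sum.
apply: addr_ge0 => //; apply: mulrn_wge0; apply: addr_ge0 => //.
by apply: sumr_ge0 => i _; rewrite /= !rmorphXn exprn_ge0 ?sqr_ge0.
Qed.

(** Used for the Lagrangian, and for f itself when K is the whole space.  That b
is also convex and nonnegative keeps f + b in the cone F when only the
Lagrangian is nonnegative everywhere. *)
Lemma convex_nonneg_perturbation f (e : R) :
  convex_poly f -> (forall x, 0 <= polyfun f x) -> 0 < e ->
  exists b, [/\ convex_poly b, forall x, 0 <= polyfun b x, l1norm b < e
              & SOS (f + b) /\ convex_poly (f + b)].
Proof.
move=> cf f0 e0; pose C : R := 1 + (1 + n%:R) *+ n`!.
have C0 : 0 < C by rewrite ltr_pwDl // mulrn_wge0 // addr_ge0.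
have c0 : 0 < e / (2 * C) by rewrite divr_gt0 // mulr_gt0.
have [d sd] := SOS_add_even_power_bump (nonneg_l1_limit f0) c0.
exists ((e / (2 * C)) *: even_power_bump R n d); split.
- by apply: convex_polyZ; [exact: ltW|exact: convex_even_power_bump].
- move=> x; rewrite /polyfun mevalZ mulr_ge0 ?(ltW c0) //.
  exact: polyfun_even_power_bump_ge0.
- rewrite l1normZ gtr0_norm //.
  apply: le_lt_trans (ler_wpM2l (ltW c0) (l1norm_even_power_bump _ _ _)) _.
  by rewrite -/C invfM mulrA divfK ?gt_eqF // ltr_pdivrMr // ltr_pMr // ltr1n.
- split => //; apply: convex_polyD => //; apply: convex_polyZ; first exact: ltW.
  exact: convex_even_power_bump.
Qed.

End ConvexPolynomials.

Theorem theorem2p6 (R : realType) (n m : nat) (g : 'I_m -> mpoly n R)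
    (g_concave : forall j, concave_poly (g j))
    (slater : exists2 z, Kset g z & forall j, 0 < polyfun (g j) z) :
  l1_dense (Qc g `&` Fcone (Kset g)) (Fcone (Kset g)) /\
  (Kset g = [set: 'rV[R]_n] ->
    l1_dense (@SOS R n `&` Fcone (Kset g)) (Fcone (Kset g))).
Proof.
split=> [|KT] f [cf f0] e e0; last first.
  have fT x : 0 <= polyfun f x by apply: f0; rewrite KT.
  have [b [cb b0 be [sfb cfb]]] := convex_nonneg_perturbation cf fT e0.
  exists (f + b); last by rewrite opprD addrA subrr add0r l1normN.
  split=> //; split=> // x _.
  by rewrite /polyfun mevalD addr_ge0 //; [exact: fT|exact: b0].
have [z _ gz] := slater.
have [c c0 Lc] : exists2 c : 'I_m -> R, forall j, 0 <= c j & forall x,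
    [set: 'rV[R]_n] x -> 0 <= polyfun f x - \sum_j c j * polyfun (g j) x.
  apply: (@convex_farkas _ _ _ _ _ _ z) => //.
  - exact/convex_polyP.
  - by move=> j; apply/concave_polyP.
  - by move=> x _ gx; apply: f0.
pose L := f + \sum_j c j *: - g j.
have L0 x : 0 <= polyfun L x.
  suff -> : polyfun L x = polyfun f x - \sum_j c j * polyfun (g j) x.
    exact: Lc.
  rewrite /polyfun mevalD [in LHS]rmorph_sum /= -sumrN; congr (_ + _).
  by apply: eq_bigr => j _; rewrite mevalZ mevalN mulrN.
have cL : convex_poly L.
  apply: convex_polyD => //; apply: convex_poly_sum => j.
  apply: convex_polyZ => //; apply/convex_polyP => x y t Dx Dy t01.
  have /concave_polyP := g_concave j; rewrite /polyfun !mevalN; exact.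
have [b [cb b0 be [sLb cLb]]] := convex_nonneg_perturbation cL L0 e0.
exists (f + b); last by rewrite opprD addrA subrr add0r l1normN.
split; last first.
  split=> [|x Kx]; first exact: convex_polyD.
  by rewrite /polyfun mevalD addr_ge0 //; [exact: f0|exact: b0].
exists (L + b), c; split=> //.
have -> : L = f - \sum_(j < m) c j *: g j.
  by rewrite /L -sumrN; congr (_ + _); apply: eq_bigr => j _; rewrite scalerN.
by rewrite addrAC subrK.
Qed.
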